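(* Let $\mathcal{L}$ be a positive-definite linear functional on $\mathbb{C}[z]$ with monic OPS $\{P_n(z)\}_{n=0}^\infty$ and monic Jacobi matrix $J_m$, let $c\in\mathbb{R}$, $a\in[0,\infty)$, and let $\kappa\in\mathbb{C}\setminus\mathbb{R}$. If $J_m$ is in the Nevai class $\mathcal{N}(a,c)$, then the Christoffel transformation $J_m^*$ of $J_m$ at $\kappa$ is also in the Nevai class $\mathcal{N}(a,c)$.
   Context: A linear functional $\mathcal{L}:\mathbb{C}[z]\to\mathbb{C}$ is positive-definite if $\mathcal{L}[p]>0$ for every polynomial $p$ that is not identically zero and is non-negative on $\mathbb{R}$. A monic orthogonal polynomial system (OPS) with respect to a functional is a sequence of monic polynomials $P_n$ with $\deg P_n=n$, $\mathcal{L}[P_nP_m]=0$ for $n\neq m$, and $\mathcal{L}[P_n^2]\neq0$ for all $n$. A monic OPS satisfies $P_0=1$, $P_1(z)=z-c_1$, $zP_n(z)=P_{n+1}(z)+c_{n+1}P_n(z)+\lambda_{n+1}P_{n-1}(z)$ for $n\ge1$, with complex $c_n$ ($n\ge1$) and $\lambda_n\ne0$ ($n\ge2$); its monic Jacobi matrix is the semi-infinite tridiagonal matrix with diagonal $c_1,c_2,\dots$, superdiagonal $1,1,\dots$ and subdiagonal $\lambda_2,\lambda_3,\dots$. In the positive-definite case $c_n\in\mathbb{R}$, $\lambda_n>0$, and all zeros of $P_n$ are real. The OPS (or its monic Jacobi matrix) is in the Nevai class $\mathcal{N}(a,c)$, with $c\in\mathbb{R}$, $a\in[0,\infty)$, if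 $c_n\to c$ and $\lambda_n\to a$ (the same definition is used when $c_n,\lambda_n$ are complex). The Christoffel transformation of $\mathcal{L}$ at $\kappa$ is $\mathcal{L}^*[p(z)]=\mathcal{L}[(z-\kappa)p(z)]$. For positive-definite $\mathcal{L}$ and $\kappa\in\mathbb{C}\setminus\mathbb{R}$ its monic OPS consists of the kernel polynomials $$P_n^*(\kappa,z)=(z-\kappa)^{-1}\left[P_{n+1}(z)-\frac{P_{n+1}(\kappa)}{P_n(\kappa)}P_n(z)\right],\quad n\ge0,$$ and $J_m^*=J_m^*(\kappa)$ denotes the monic Jacobi matrix of this OPS. *)

(* Defs.v *)
From HB Require Import structures.
From mathcomp Require Import all_boot all_order all_algebra.
From mathcomp Require Import complex.
From mathcomp Require Import boolp classical_sets reals topology normedtype sequences.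

Set Implicit Arguments.
Unset Strict Implicit.
Unset Printing Implicit Defensive.

Import Order.TTheory GRing.Theory Num.Theory.
Import numFieldNormedType.Exports.

Local Open Scope classical_set_scope.
Local Open Scope ring_scope.
Local Open Scope complex_scope.

(* On R[i] the order is the partial one: 0 <= z (resp. 0 < z) means that z is  *)
(* real and nonnegative (resp. positive).                                      *)
Definition positive_definite (R : realType) (L : {scalar {poly R[i]}}) : Prop :=
  forall p : {poly R[i]},
    p != 0 -> (forall x : R, 0 <= p.[x%:C]) -> 0 < L p.

Definition monic_OPS (R : realType) (L : {scalar {poly R[i]}})
    (P : nat -> {poly R[i]}) : Prop :=
  [/\ forall n, P n \is monic,
      forall n, size (P n) = n.+1,
      forall n m, n != m -> L (P n * P m) = 0
    & forall n, L (P n ^+ 2) != 0].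

Definition infinite_matrix (R : realType) := nat -> nat -> R[i].

(* The coefficients keep their usual indices c_1, c_2, ... and lambda_2, ...   *)
(* (the values c 0, lam 0, lam 1 are never used), while the rows and columns   *)
(* of the matrix are numbered from 0.                                          *)
Definition monic_jacobi_mx (R : realType) (c lam : nat -> R[i]) :
    infinite_matrix R :=
  fun i j => if j == i then c i.+1
             else if j == i.+1 then 1
             else if i == j.+1 then lam i.+1
             else 0.

Definition three_term_recurrence (R : realType) (P : nat -> {poly R[i]})
    (c lam : nat -> R[i]) : Prop :=
  [/\ P 0%N = 1,
      P 1%N = 'X - (c 1%N)%:P,
      forall n, (1 <= n)%N ->
        'X * P n = P n.+1 + c n.+1 *: P n + lam n.+1 *: P n.-1
    & forall n, (2 <= n)%N -> lam n != 0].

Definition is_monic_jacobi_of (R : realType) (P : nat -> {poly R[i]})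
    (J : infinite_matrix R) : Prop :=
  exists c lam, three_term_recurrence P c lam /\ J = monic_jacobi_mx c lam.

(* R[i]^o is R[i] with the topology of its norm.                               *)
Definition nevai_class (R : realType) (a c : R) (J : infinite_matrix R) : Prop :=
  J n n @[n --> \oo] --> (c%:C : R[i]^o) /\
  J n.+1 n @[n --> \oo] --> (a%:C : R[i]^o).

Definition christoffel (R : realType) (kappa : R[i]) (L : {scalar {poly R[i]}})
    (p : {poly R[i]}) : R[i] := L (('X - kappa%:P) * p).

Fact christoffel_is_scalar (R : realType) (kappa : R[i])
    (L : {scalar {poly R[i]}}) : scalar (christoffel kappa L).
Proof.
by move=> b p q; rewrite /christoffel mulrDr -scalerAr linearP.
Qed.

HB.instance Definition _ (R : realType) (kappa : R[i])
    (L : {scalar {poly R[i]}}) :=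
  GRing.isLinear.Build R[i] {poly R[i]} R[i] *%R (christoffel kappa L)
    (christoffel_is_scalar kappa L).

(* The numerator vanishes at kappa, so that the Euclidean division is exact.   *)
Definition kernel_poly (R : realType) (P : nat -> {poly R[i]}) (kappa : R[i])
    (n : nat) : {poly R[i]} :=
  (P n.+1 - ((P n.+1).[kappa] / (P n).[kappa]) *: P n) %/ ('X - kappa%:P).

Lemma three_term_size (R : realType) (P : nat -> {poly R[i]})
    (c lam : nat -> R[i]) (n : nat) :
  three_term_recurrence P c lam -> size (P n) = n.+1.
Proof.
move=> [P0 P1 Prec _].
suff: size (P n) = n.+1 /\ size (P n.+1) = n.+2 by case.
elim: n => [|n [szn szn1]]; first by rewrite P0 P1 size_poly1 size_XsubC.
split=> //; have /= E := Prec n.+1 isT.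
have -> : P n.+2 = 'X * P n.+1 - (c n.+2 *: P n.+1 + lam n.+2 *: P n).
  by rewrite E -(addrA (P n.+2)) addrK.
have P1n0 : P n.+1 != 0 by rewrite -size_poly_eq0 szn1.
have szX : size ('X * P n.+1) = n.+3 by rewrite mulrC size_mulX // szn1.
rewrite size_polyDl szX // size_polyN ltnS.
apply: leq_trans (size_polyD _ _) _; rewrite geq_max.
apply/andP; split; apply: leq_trans (size_scale_leq _ _) _;
  by rewrite ?szn ?szn1.
Qed.

Lemma is_monic_jacobi_of_uniq (R : realType) (P : nat -> {poly R[i]})
    (J J' : infinite_matrix R) :
  is_monic_jacobi_of P J -> is_monic_jacobi_of P J' -> J = J'.
Proof.
move=> [c [lam [rec ->]]] [c' [lam' [rec' ->]]].
have sz n := three_term_size n rec.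
have nz n : P n != 0 by rewrite -size_poly_eq0 sz.
have [_ P1 Prec _] := rec; have [_ P1' Prec' _] := rec'.
have cl n : (0 < n)%N -> c n.+1 = c' n.+1 /\ lam n.+1 = lam' n.+1.
  case: n => // n _; have := Prec' n.+1 isT; rewrite (Prec n.+1 isT) /=.
  rewrite -!addrA => /addrI E.
  have {}E : (c n.+2 - c' n.+2) *: P n.+1 = (lam' n.+2 - lam n.+2) *: P n.
    have aux (p q r s : {poly R[i]}) : p + q = r + s -> p - r = s - q.
      by move=> e; apply/eqP; rewrite subr_eq addrAC (addrC s) -e addrK.
    by rewrite !scalerBl; apply: aux.
  have ec : c n.+2 - c' n.+2 = 0.
    apply/eqP; apply: contraT => h.
    have := size_scale_leq (lam' n.+2 - lam n.+2) (P n).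
    by rewrite -E size_scale // !sz ltnn.
  split; first by apply/eqP; rewrite -subr_eq0 ec.
  move: E; rewrite ec scale0r => /esym/eqP.
  by rewrite scaler_eq0 (negPf (nz n)) orbF subr_eq0 eq_sym => /eqP.
have c1 : c 1%N = c' 1%N.
  by move: P1'; rewrite P1 => /addrI/oppr_inj/polyC_inj.
apply/funext => i; apply/funext => j; rewrite /monic_jacobi_mx.
case: eqP => _; first by case: i => [|i] //; have [] := cl i.+1 isT.
case: eqP => // _; case: eqP => // ->.
by have [] := cl j.+1 isT.
Qed.

(* Main.v *)
Require Import Defs.
From HB Require Import structures.
From mathcomp Require Import all_boot all_order all_algebra.
From mathcomp Require Import complex.
From mathcomp Require Import boolp classical_sets reals topology normedtype sequences.
From mathcomp Require Import ring lra.

Set Implicit Arguments.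
Unset Strict Implicit.
Unset Printing Implicit Defensive.

Import Order.TTheory GRing.Theory Num.Theory.
Import numFieldNormedType.Exports.
Import ComplexField.Normc.

Local Open Scope classical_set_scope.
Local Open Scope ring_scope.
Local Open Scope complex_scope.

(** Put r_n = P_{n+1}(kappa) / P_n(kappa).  The kernel polynomials satisfy
    P_{n+1} = P*_{n+1} - (lambda_{n+2} / r_n) P*_n, whence
      c*_n = c_{n+1} + (r_n - r_{n-1}),
      lambda*_n = lambda_n r_{n-1} / r_{n-2}.
    As |r_n| >= |Im kappa|, it is enough that r_{n+1} - r_n -> 0.  Now
    r_{n+1} = kappa - c_{n+2} - lambda_{n+2} / r_n with real c and positive
    lambda, a map that strictly contracts the hyperbolic metric of the half
    plane of kappa.  With v_n = Im r_n / Im kappa, which lies in [1, M], the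
    quantity u_n = |r_{n+1} - r_n| / sqrt (v_n v_{n+1}) satisfies
    u_{n+1} <= e_n + q u_n, where e_n -> 0 and q = 1 - 1 / (2 M). *)

(** * Perturbed contractions of real sequences *)

(** Once [e n] is below [(1 - q) * (eps / 2)], the sequence is dominated by the iteration of x -> (1
    - q) eps/2 + q x. Its fixed point is eps/2 and the distance to it decays like q^k, which leaves
    a margin of eps/2. *)
Lemma cvg0_contraction (R : realType) (q : R) (u e : nat -> R) :
  0 <= q < 1 -> (forall n, 0 <= u n) ->
  (\forall n \near \oo, u n.+1 <= e n + q * u n) ->
  e n @[n --> \oo] --> 0 -> u n @[n --> \oo] --> 0.
Proof.
move=> /andP[q0 q1] u0 ue e0; apply/cvgr0Pnorm_lt => eps eps0.
have d0 : 0 < (1 - q) * (eps / 2) by rewrite mulr_gt0 ?divr_gt0 ?subr_gt0.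
have [N _ HN] : \forall n \near \oo,
    u n.+1 <= (1 - q) * (eps / 2) + q * u n.
  have {}e0 := @cvgr0_norm_lt _ _ _ _ _ _ e0 _ d0.
  near=> n; apply: le_trans (_ : e n + q * u n <= _); first by near: n.
  rewrite lerD2r ltW// (le_lt_trans (ler_norm _))//; near: n; exact: e0.
have bnd k : u (k + N)%N <= eps / 2 + q ^+ k * u N.
  elim: k => [|k IH]; first by rewrite expr0 mul1r lerDr divr_ge0 ?ltW.
  apply: le_trans (HN (k + N)%N _) _; first exact: leq_addl.
  have := ler_wpM2l q0 IH; rewrite exprS; lra.
have qk : q ^+ k * u N @[k --> \oo] --> (0 : R).
  rewrite -[X in _ --> X](mul0r (u N)); apply: cvgM; last exact: cvg_cst.
  by apply: cvg_expr; rewrite ger0_norm.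
have e2 : 0 < eps / 2 by rewrite divr_gt0.
have [K _ HK] := @cvgr0_norm_lt _ _ _ _ _ _ qk _ e2.
exists (K + N)%N => // n /= leKNn.
have leNn : (N <= n)%N by apply: leq_trans leKNn; exact: leq_addl.
rewrite ger0_norm // -(subnK leNn); apply: le_lt_trans (bnd _) _.
have /HK /(le_lt_trans (ler_norm _)) : (K <= n - N)%N.
  by rewrite leq_subRL // addnC.
lra.
Unshelve. all: by end_near. Qed.

(** * The real-valued modulus and limits of complex sequences *)

Lemma normc_ge0 (R : rcfType) (z : R[i]) : 0 <= normc z.
Proof. by case: z => x y; exact: sqrtr_ge0. Qed.

Lemma normcD_le (R : rcfType) (z w : R[i]) : normc (z + w) <= normc z + normc w.
Proof. exact: (@le_normcD R). Qed.

Lemma normcN_eq (R : rcfType) (z : R[i]) : normc (- z) = normc z.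
Proof. exact: (@normcN R). Qed.

Lemma normc_real (R : rcfType) (x : R) : normc x%:C = `|x|.
Proof. by rewrite /= expr0n addr0 sqrtr_sqr. Qed.

Lemma normc_sqr (R : rcfType) (z : R[i]) :
  normc z ^+ 2 = complex.Re z ^+ 2 + complex.Im z ^+ 2.
Proof. by case: z => x y; rewrite sqr_sqrtr // addr_ge0 ?sqr_ge0. Qed.

(** The norm of [R[i]^o] takes its values in [R[i]]. Passing to [normc] turns complex limits into
    limits in [R], where squeezing is available. *)
Lemma cvg_normcP (R : realType) (u : nat -> R[i]) (l : R[i]) :
  (u n @[n --> \oo] --> (l : R[i]^o)) <->
  (normc (u n - l) @[n --> \oo] --> (0 : R)).
Proof.
have distE n : `|(l : R[i]^o) - u n| = (normc (u n - l))%:C.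
  by rewrite (@distrC R[i] R[i]^o).
have normE n : `|normc (u n - l)| = normc (u n - l).
  by rewrite ger0_norm // normc_ge0.
split.
  move=> /(@cvgrPdist_lt R[i] R[i]^o) ul; apply/cvgr0Pnorm_lt => eps eps0.
  have := ul eps%:C; rewrite ltcR => /(_ eps0) [N _ HN].
  by exists N => // n /HN /=; rewrite normE distE ltcR.
move=> /cvgr0Pnorm_lt ul; apply/(@cvgrPdist_lt R[i] R[i]^o) => eps eps0.
have epsE : eps = (complex.Re eps)%:C by rewrite RRe_real // gtr0_real.
have := ul (complex.Re eps); rewrite -ltcR -epsE => /(_ eps0) [N _ HN].
by exists N => // n /HN /=; rewrite normE distE epsE ltcR.
Qed.

Lemma normc_cvgD (R : realType) (u v : nat -> R[i]) (l m : R[i]) :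
  normc (u n - l) @[n --> \oo] --> (0 : R) ->
  normc (v n - m) @[n --> \oo] --> (0 : R) ->
  normc (u n + v n - (l + m)) @[n --> \oo] --> (0 : R).
Proof.
move=> ul vm.
apply: (@squeeze_cvgr _ _ _ _ (fun=> 0)
  (fun n => normc (u n - l) + normc (v n - m))).
- apply: nearW => n; rewrite normc_ge0 opprD addrACA /=; exact: normcD_le.
- exact: cvg_cst.
- by rewrite -[X in _ --> X](addr0 (0 : R)); exact: cvgD.
Qed.

Lemma normc_cvgM (R : realType) (u v : nat -> R[i]) (l m : R[i]) :
  normc (u n - l) @[n --> \oo] --> (0 : R) ->
  normc (v n - m) @[n --> \oo] --> (0 : R) ->
  normc (u n * v n - l * m) @[n --> \oo] --> (0 : R).
Proof.
move=> ul vm.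
apply: (@squeeze_cvgr _ _ _ _ (fun=> 0)
  (fun n => normc (u n - l) * normc (v n - m) +
    (normc (u n - l) * normc m + normc l * normc (v n - m)))).
- apply: nearW => n; rewrite normc_ge0 -!normcM /=.
  have -> : u n * v n - l * m =
      (u n - l) * (v n - m) + ((u n - l) * m + l * (v n - m)) by ring.
  apply: le_trans (normcD_le _ _) _; rewrite lerD2l; exact: normcD_le.
- exact: cvg_cst.
- have -> : 0 = 0 * 0 + (0 * normc m + normc l * 0) :> R.
    by rewrite !mul0r mulr0 !addr0.
  by apply: cvgD; [|apply: cvgD]; apply: cvgM => //; exact: cvg_cst.
Qed.

Lemma cvg_Re_real (R : realType) (u : nat -> R[i]) (l : R) :
  (forall n, u n \is Num.real) -> u n @[n --> \oo] --> (l%:C : R[i]^o) ->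
  complex.Re (u n) @[n --> \oo] --> l.
Proof.
move=> ureal /cvg_normcP ul; apply/subr_cvg0/norm_cvg0P.
have uE n : normc (u n - l%:C) = `|complex.Re (u n) - l|.
  by rewrite -[in LHS](RRe_real (ureal n)) -rmorphB normc_real.
by under eq_fun do rewrite -uE.
Qed.

(** * The imaginary part measured against that of kappa *)

Lemma Im_real_div (R : rcfType) (x : R) (z : R[i]) :
  complex.Im (x%:C / z) = - (x * complex.Im z / normc z ^+ 2).
Proof.
by rewrite normc_sqr; case: z => p q /=; rewrite mul0r addr0 mulrN mulrA.
Qed.

(** Dividing by Im kappa treats both half planes at once: the value is positive exactly when z lies
    on the same side of the real axis as kappa. *)
Definition relIm (R : rcfType) (kappa z : R[i]) : R :=
  complex.Im z / complex.Im kappa.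

(** The real shift b has no imaginary part, kappa contributes 1, and -Im(l/z) = l Im z / |z|^2. *)
Lemma relIm_step (R : rcfType) (kappa z : R[i]) (b l : R) :
  complex.Im kappa != 0 ->
  relIm kappa (kappa - b%:C - l%:C / z) =
  1 + l * relIm kappa z / normc z ^+ 2.
Proof.
move=> y0; rewrite /relIm !raddfB /= Im_real_div opprK subr0 mulrDl divff //.
by congr (_ + _); rewrite mulrAC -!mulrA.
Qed.

Lemma relIm_normc (R : rcfType) (kappa z : R[i]) :
  complex.Im kappa != 0 ->
  (relIm kappa z * complex.Im kappa) ^+ 2 <= normc z ^+ 2.
Proof.
by move=> y0; rewrite /relIm divfK // normc_sqr lerDr sqr_ge0.
Qed.

Lemma normc_ge_Im (R : rcfType) (kappa z : R[i]) :
  complex.Im kappa != 0 -> 1 <= relIm kappa z ->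
  `|complex.Im kappa| <= normc z.
Proof.
move=> y0 z1; rewrite -ler_sqr ?nnegrE ?normr_ge0 ?normc_ge0 //.
rewrite real_normK ?num_real //; apply: le_trans (relIm_normc z y0).
by rewrite exprMn ler_peMl ?sqr_ge0 // exprn_ege1.
Qed.

(** * Hyperbolic contraction along the ratio recursion *)

Lemma ratio_diff_cvg0 (R : realType) (kappa : R[i]) (b l : nat -> R)
    (r : nat -> R[i]) (a c : R) :
  complex.Im kappa != 0 -> (forall n, 0 < l n) ->
  b n @[n --> \oo] --> c -> l n @[n --> \oo] --> a ->
  (forall n, 1 <= relIm kappa (r n)) ->
  (forall n, r n.+1 = kappa - (b n)%:C - (l n)%:C / r n) ->
  normc (r n.+1 - r n) @[n --> \oo] --> (0 : R).
Proof.
move=> y0 l0 bc la v1 rS.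
set y := complex.Im kappa in y0; pose v n := relIm kappa (r n).
pose s n := normc (r n).
have a0 : 0 <= a.
  rewrite -(cvg_lim _ la) //; apply: limr_ge; first by apply/cvg_ex; exists a.
  by apply: nearW => n; exact: ltW.
have v0 n : 0 < v n by apply: lt_le_trans (v1 n).
have y2 : 0 < y ^+ 2 by rewrite exprn_even_gt0.
have sv n : v n * y ^+ 2 <= s n ^+ 2.
  apply: le_trans (relIm_normc (r n) y0).
  by rewrite exprMn ler_pM2r // -[leLHS]mulr1 expr2 ler_pM2l.
have sy n : `|y| <= s n by exact: normc_ge_Im.
have s0 n : 0 < s n by apply: lt_le_trans (sy n); rewrite normr_gt0.
have vS n : v n.+1 = 1 + l n * v n / s n ^+ 2 by rewrite /v rS relIm_step.
(* By [sv], v_n / s_n^2 <= 1 / y^2, so v_{n+1} <= 1 + B / y^2 for any bound B of l. The summand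
   [v 0] covers the index 0. *)
have [M M0 vM] : exists2 M, 0 < M & forall n, v n <= M.
  have [B B0 lB] : exists2 B, 0 < B & forall n, l n <= B.
    have /cvg_seq_bounded/pinfty_ex_gt0[B B0 lB] : cvgn l.
      by apply/cvg_ex; exists a.
    exists B => // n; apply: le_trans (ler_norm _) _; exact: lB.
  exists (v 0%N + (1 + B / y ^+ 2)).
    by rewrite addr_gt0 ?v0 // addr_gt0 // divr_gt0.
  case=> [|n]; first by rewrite lerDl addr_ge0 // divr_ge0 // ltW.
  rewrite vS; apply: ler_wpDl; first exact: ltW.
  rewrite lerD2l ler_pdivrMr ?exprn_gt0 // mulrAC ler_pdivlMr // -mulrA.
  by apply: ler_pM => //; apply: ltW => //; exact: mulr_gt0.
pose g n := Num.sqrt (v n).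
have g0 n : 0 < g n by rewrite sqrtr_gt0.
have g1 n : 1 <= g n by rewrite -sqrtr1 ler_sqrt ?(ltW (v0 n)) //; exact: v1.
have gg n : g n ^+ 2 = v n by rewrite sqr_sqrtr // ltW.
(* This constant makes v - 1/2 <= q v whenever v <= M. *)
pose q := 1 - (2 * M)^-1.
have M1 : 1 <= M by apply: le_trans (vM 0%N); exact: v1.
have q01 : 0 <= q < 1.
  rewrite /q gtrBl invr_gt0 mulr_gt0 // andbT subr_ge0 invf_le1 ?mulr_gt0 //.
  by move: M1; lra.
have [q0 _] := andP q01.
pose d n := normc (r n.+1 - r n).
pose e n := `|b n - b n.+1| + (`|l n - a| + `|l n.+1 - a|) / `|y|.
have e0 : e n @[n --> \oo] --> (0 : R).
  have bS : b n.+1 @[n --> \oo] --> c by rewrite cvg_shiftS.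
  have lS : l n.+1 @[n --> \oo] --> a by rewrite cvg_shiftS.
  have -> : 0 = `|c - c| + (`|a - a| + `|a - a|) / `|y| :> R.
    by rewrite !subrr !normr0 addr0 mul0r addr0.
  apply: cvgD; first by apply: cvg_norm; exact: cvgB.
  apply: cvgM; last exact: cvg_cst.
  by apply: cvgD; apply: cvg_norm; apply: cvgB => //; exact: cvg_cst.
(* Replacing both l_n and l_{n+1} by a leaves a (1/r_n - 1/r_{n+1}), which is a (r_{n+1} - r_n) /
   (r_n r_{n+1}). The replacement errors and the variation of b make up [e n], thanks to |r_n| >=
   |y|. *)
have dS n : d n.+1 <= e n + a / (s n * s n.+1) * d n.
  have rn0 m : r m != 0.
    by apply/eqP => rm; have := s0 m; rewrite /s rm normc0 ltxx.
  have -> : a / (s n * s n.+1) * d n =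
      normc (a%:C / (r n * r n.+1) * (r n.+1 - r n)).
    by rewrite !normcM normcV normcM normc_real ger0_norm.
  have lE m k : normc ((l m - a)%:C / r k) <= `|l m - a| / `|y|.
    rewrite normcM normcV normc_real ler_wpM2l // lef_pV2 ?posrE ?normr_gt0 //.
      exact: sy.
    exact: s0.
  rewrite [d n.+1]/d.
  have -> : r n.+2 - r n.+1 = (b n - b n.+1)%:C +
      ((l n - a)%:C / r n - (l n.+1 - a)%:C / r n.+1) +
      a%:C / (r n * r n.+1) * (r n.+1 - r n).
    rewrite [r n.+2]rS [X in _ - X = _]rS !rmorphB /=.
    have := rn0 n; have := rn0 n.+1.
    by move=> ? ?; field; apply/andP.
  apply: le_trans (normcD_le _ _) _; rewrite lerD2r.
  apply: le_trans (normcD_le _ _) _; rewrite normc_real lerD2l mulrDl.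
  by apply: le_trans (normcD_le _ _) _; rewrite normcN_eq lerD.
(* The exact identity is l v_m / |r_m|^2 = v_{m+1} - 1; replacing l by its limit
   a costs at most 1/2 once l is close to a. *)
have key m : `|l m - a| <= y ^+ 2 / 2 -> a * v m <= q * v m.+1 * s m ^+ 2.
  rewrite distrC => /(le_trans (ler_norm _)) /(ler_wpM2r (ltW (v0 m))) h1.
  have h2 : (v m.+1 - 1) * s m ^+ 2 = l m * v m.
    by rewrite vS addrAC subrr add0r divfK // gt_eqF // exprn_gt0.
  have h3 : v m.+1 - 2^-1 <= q * v m.+1.
    have : v m.+1 / (2 * M) <= 2^-1.
      by rewrite ler_pdivrMr ?mulr_gt0 // mulKf ?pnatr_eq0.
    rewrite /q; lra.
  apply: le_trans (ler_wpM2r (sqr_ge0 (s m)) h3).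
  by move: h1 h2 (sv m); lra.
have key2 n : `|l n - a| <= y ^+ 2 / 2 -> `|l n.+1 - a| <= y ^+ 2 / 2 ->
    a / (s n * s n.+1) <= q * g n.+2 / g n.
  move=> /key k1 /key k2.
  rewrite ler_pdivrMr ?mulr_gt0 // mulrAC ler_pdivlMr //.
  rewrite -ler_sqr ?nnegrE ?mulr_ge0 ?(ltW (g0 _)) ?(ltW (s0 _)) //.
  (* Multiplying the two instances of [key] leaves a common factor v_{n+1}. *)
  rewrite !exprMn !gg -(ler_pM2r (v0 n.+1)).
  have := ler_pM (mulr_ge0 a0 (ltW (v0 n))) (mulr_ge0 a0 (ltW (v0 n.+1))) k1 k2.
  by congr (_ <= _); ring.
(* Up to the factor 2 |y|, this is sinh of half the hyperbolic distance between r_n and r_{n+1}. *)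
pose u n := d n / (g n * g n.+1).
have u0 n : 0 <= u n by rewrite divr_ge0 ?normc_ge0 // mulr_ge0 // ltW.
have uS : \forall n \near \oo, u n.+1 <= e n + q * u n.
  have y22 : 0 < y ^+ 2 / 2 by rewrite divr_gt0.
  have [N _ HN] := @cvgr_dist_lt _ _ _ _ _ _ _ la _ y22.
  exists N => // n /= Nn.
  have k : a / (s n * s n.+1) <= q * g n.+2 / g n.
    by apply: key2; rewrite ltW // distrC; apply: HN => //=; exact: leqW.
  have gg0 : 0 < g n.+1 * g n.+2 by rewrite mulr_gt0.
  rewrite /u ler_pdivrMr //; apply: le_trans (dS n) _.
  rewrite mulrDl lerD //.
    (* As every [g] is at least 1, dividing by the weights does not enlarge [e n]. *)
    rewrite ler_peMr //; first by rewrite addr_ge0 ?divr_ge0 ?addr_ge0.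
    by rewrite -[leLHS]mul1r ler_pM.
  apply: le_trans (ler_wpM2r (normc_ge0 _) k) _.
  have -> : q * (d n / (g n * g n.+1)) * (g n.+1 * g n.+2) =
            q * g n.+2 / g n * d n.
    by field; rewrite !gt_eqF.
  exact: lexx.
have ucvg := cvg0_contraction q01 u0 uS e0.
apply: (@squeeze_cvgr _ _ _ _ (fun=> 0) (fun n => M * u n)).
- apply: nearW => n; rewrite normc_ge0 /= /u mulrA ler_pdivlMr ?mulr_gt0 //.
  rewrite mulrC ler_wpM2r ?normc_ge0 //.
  (* By the inequality of arithmetic and geometric means, g_n g_{n+1} <= (v_n + v_{n+1}) / 2 <=
     M. *)
  have := vM n; have := vM n.+1; rewrite -!gg.
  have := sqr_ge0 (g n - g n.+1); rewrite !expr2; lra.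
- exact: cvg_cst.
- by rewrite -(mulr0 M); apply: cvgM => //; exact: cvg_cst.
Qed.

(** * Reality and positivity of the Jacobi coefficients *)

Lemma positive_definite_real (R : realType) (L : {scalar {poly R[i]}})
    (p : {poly R[i]}) :
  positive_definite L -> (forall x : R, p.[x%:C] \is Num.real) ->
  L p \is Num.real.
Proof.
move=> Lpos preal.
have Lsqr (q : {poly R[i]}) : (forall x : R, q.[x%:C] \is Num.real) ->
    L (q ^+ 2) \is Num.real.
  move=> qreal; have [->|q0] := eqVneq (q ^+ 2) 0.
    by rewrite linear0 real0.
  apply: gtr0_real; apply: Lpos => // x.
  by rewrite horner_exp real_exprn_even_ge0.
(* Polarization: p is a combination of two squares, on which L is positive. *)
have -> : p = 4^-1 *: ((p + 1) ^+ 2 - (p - 1) ^+ 2).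
  have -> : (p + 1) ^+ 2 - (p - 1) ^+ 2 = (4 : R[i]) *: p.
    by rewrite scaler_nat; ring.
  by rewrite scalerA mulVf ?scale1r // pnatr_eq0.
rewrite linearZ linearB /= realM ?realV ?realn // realB // Lsqr // => x.
  by rewrite !hornerE realD // real1.
by rewrite !hornerE realB // real1.
Qed.

(** Orthogonality gives c_{n+1} = L(x P_n^2) / L(P_n^2) and lambda_{n+2} = L(P_{n+1}^2) / L(P_n^2).
    The signs follow once the P_n are real on the real line, and this reality is in turn propagated
    by the recurrence with real coefficients. *)
Lemma monic_OPS_jacobi_real (R : realType) (L : {scalar {poly R[i]}})
    (P : nat -> {poly R[i]}) (c lam : nat -> R[i]) :
  positive_definite L -> monic_OPS L P -> three_term_recurrence P c lam ->
  (forall n, c n.+1 \is Num.real) /\ (forall n, 0 < lam n.+2).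
Proof.
move=> Lpos [_ _ Lorth Lsq] [P0 P1 Prec _].
have Psq_gt0 n : (forall x : R, (P n).[x%:C] \is Num.real) -> 0 < L (P n ^+ 2).
  move=> Pn; apply: Lpos => [|x]; last first.
    by rewrite horner_exp real_exprn_even_ge0.
  by apply/eqP => Pn0; have := Lsq n; rewrite Pn0 linear0 eqxx.
(* The recurrence starts at n = 1; this is its instance at n = 0, without a lambda term. *)
have X0 : 'X * P 0%N = P 1%N + c 1%N *: P 0%N.
  by rewrite P0 P1 mulr1 alg_polyC subrK.
have LX_next n : L (P n.+1 * ('X * P n)) = L (P n.+1 ^+ 2).
  case: n => [|n]; first rewrite X0; last rewrite Prec //;
    rewrite !mulrDr -!scalerAr !linearD !linearZ /= -expr2.
    by rewrite (Lorth 1%N 0%N) // mulr0 addr0.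
  rewrite (Lorth n.+2 n.+1) ?gtn_eqF // (Lorth n.+2 n) ?gtn_eqF //.
  by rewrite !mulr0 !addr0.
have LX_prev n : L (P n * ('X * P n.+1)) = lam n.+2 * L (P n ^+ 2).
  rewrite Prec // !mulrDr -!scalerAr !linearD !linearZ /= -expr2.
  rewrite (Lorth n n.+2) ?ltn_eqF // (Lorth n n.+1) ?ltn_eqF //.
  by rewrite mulr0 !add0r.
have LX_same n : L (P n * ('X * P n)) = c n.+1 * L (P n ^+ 2).
  case: n => [|n]; first rewrite X0; last rewrite Prec //;
    rewrite !mulrDr -!scalerAr !linearD !linearZ /= -expr2.
    by rewrite (Lorth 0%N 1%N) // add0r.
  rewrite (Lorth n.+1 n.+2) ?ltn_eqF // (Lorth n.+1 n) ?gtn_eqF //.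
  by rewrite !mulr0 add0r addr0.
have creal n : (forall x : R, (P n).[x%:C] \is Num.real) -> c n.+1 \is Num.real.
  move=> Pn; have Ln := Psq_gt0 n Pn.
  have -> : c n.+1 = L (P n * ('X * P n)) / L (P n ^+ 2).
    by rewrite LX_same mulfK // gt_eqF.
  apply: realM; last by rewrite realV gtr0_real.
  apply: positive_definite_real => // x.
  by rewrite !hornerE !realM // complex_real.
have lam_gt0 n : (forall x : R, (P n).[x%:C] \is Num.real) ->
    (forall x : R, (P n.+1).[x%:C] \is Num.real) -> 0 < lam n.+2.
  move=> Pn Pn1; rewrite -(pmulr_lgt0 _ (Psq_gt0 n Pn)).
  by rewrite -LX_prev mulrCA [P n * _]mulrC mulrCA LX_next; exact: Psq_gt0.
(* The induction carries two consecutive polynomials, since the recurrence has order two and the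
   sign of lambda_{n+2} uses both. *)
have Preal n : (forall x : R, (P n).[x%:C] \is Num.real) /\
    (forall x : R, (P n.+1).[x%:C] \is Num.real).
  elim: n => [|n [Pn Pn1]].
    have P0r (x : R) : (P 0%N).[x%:C] \is Num.real by rewrite P0 hornerC real1.
    split=> // x; rewrite P1 !hornerE realB //; first by rewrite complex_real.
    exact: creal.
  split=> // x.
  have -> : P n.+2 = 'X * P n.+1 - c n.+2 *: P n.+1 - lam n.+2 *: P n.
    by rewrite Prec //=; ring.
  rewrite !hornerE !realB // realM //; first by rewrite complex_real.
    exact: creal.
  exact/gtr0_real/lam_gt0.
split=> n; have [Pn Pn1] := Preal n; [exact: creal | exact: lam_gt0].
Qed.

(** * Ratios of consecutive polynomials at kappa *)

Definition ratio_at (R : realType) (P : nat -> {poly R[i]}) (kappa : R[i])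
    (n : nat) : R[i] :=
  (P n.+1).[kappa] / (P n).[kappa].

Lemma ratio_atS (R : realType) (P : nat -> {poly R[i]}) (c lam : nat -> R[i])
    (kappa : R[i]) (n : nat) :
  three_term_recurrence P c lam -> (P n.+1).[kappa] != 0 ->
  ratio_at P kappa n.+1 = kappa - c n.+2 - lam n.+2 / ratio_at P kappa n.
Proof.
move=> [_ _ Prec _] Pn1; rewrite /ratio_at invf_div.
have -> : P n.+2 = 'X * P n.+1 - c n.+2 *: P n.+1 - lam n.+2 *: P n.
  by rewrite Prec //=; ring.
by rewrite !hornerE /=; field.
Qed.

(** The first ratio kappa - c_1 has relative imaginary part 1, and each step adds a nonnegative term
    to 1. The two claims are proved together: a zero of P_{n+1} at kappa would make the preceding
    ratio 0, against the lower bound 1. *)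
Lemma relIm_ratio_at_ge1 (R : realType) (P : nat -> {poly R[i]})
    (c lam : nat -> R[i]) (kappa : R[i]) (n : nat) :
  three_term_recurrence P c lam ->
  (forall n, c n.+1 \is Num.real) -> (forall n, 0 < lam n.+2) ->
  complex.Im kappa != 0 ->
  (P n).[kappa] != 0 /\ 1 <= relIm kappa (ratio_at P kappa n).
Proof.
move=> Ptt creal lam0 y0; elim: n => [|n [Pn rn]].
  have [P0 P1 _ _] := Ptt; rewrite /ratio_at P0 P1 !hornerE oner_eq0 divr1.
  split=> //; rewrite -(RRe_real (creal 0%N)) /relIm raddfB /= subr0 divff //.
have Pn1 : (P n.+1).[kappa] != 0.
  apply/eqP => Pn1; move: rn.
  by rewrite /ratio_at Pn1 mul0r /relIm /= mul0r ler10.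
split=> //; rewrite (ratio_atS Ptt) //.
rewrite -(RRe_real (creal n.+1)) -(RRe_real (gtr0_real (lam0 n))) relIm_step //.
rewrite lerDl mulr_ge0 ?invr_ge0 ?sqr_ge0 // mulr_ge0 //.
  by rewrite -lecR RRe_real ?gtr0_real // ltW.
exact: le_trans rn.
Qed.

(** * Kernel polynomials: Darboux factorization, recurrence and orthogonality *)

Lemma kernel_polyE (R : realType) (P : nat -> {poly R[i]}) (kappa : R[i])
    (n : nat) :
  (P n).[kappa] != 0 ->
  ('X - kappa%:P) * kernel_poly P kappa n =
  P n.+1 - ratio_at P kappa n *: P n.
Proof.
move=> Pn; rewrite mulrC divpK // dvdp_XsubCl rootE !hornerE.
by rewrite divfK // subrr.
Qed.

(** With [kernel_polyE] this factors J - kappa as a unit lower bidiagonal matrix (subdiagonal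
    -lambda_{n+2} / r_n) times an upper bidiagonal one (diagonal -r_n, superdiagonal 1). *)
Lemma kernel_poly_darboux (R : realType) (P : nat -> {poly R[i]})
    (c lam : nat -> R[i]) (kappa : R[i]) (n : nat) :
  three_term_recurrence P c lam -> (forall n, (P n).[kappa] != 0) ->
  P n.+1 = kernel_poly P kappa n.+1 -
           (lam n.+2 / ratio_at P kappa n) *: kernel_poly P kappa n.
Proof.
move=> Ptt Pk; have XB0 : 'X - kappa%:P != 0 by rewrite polyXsubC_eq0.
apply: (mulfI XB0).
rewrite mulrBr -scalerAr !kernel_polyE // (ratio_atS Ptt) //.
have [_ _ Prec _] := Ptt.
have r0 : ratio_at P kappa n != 0 by rewrite mulf_neq0 ?invr_neq0.
have -> : P n.+2 = 'X * P n.+1 - c n.+2 *: P n.+1 - lam n.+2 *: P n.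
  by rewrite Prec //=; ring.
rewrite scalerBr scalerA divfK // -!mul_polyC; ring.
Qed.

(** The coefficients are read off the product of the two bidiagonal factors in reverse order. The
    predecessors [n.-1] and [n.-2] are true subtractions at the indices that matter, n >= 1 on the
    diagonal and n >= 2 below it. *)
Lemma three_term_kernel_poly (R : realType) (P : nat -> {poly R[i]})
    (c lam : nat -> R[i]) (kappa : R[i]) :
  three_term_recurrence P c lam -> (forall n, (P n).[kappa] != 0) ->
  let r := ratio_at P kappa in
  three_term_recurrence (kernel_poly P kappa)
    (fun n => c n.+1 + (r n - r n.-1)) (fun n => lam n * (r n.-1 / r n.-2)).
Proof.
move=> Ptt Pk r; have [P0 P1 Prec lam0] := Ptt.
have r0 n : r n != 0 by rewrite mulf_neq0 ?invr_neq0.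
have XB0 : 'X - kappa%:P != 0 by rewrite polyXsubC_eq0.
have step n := kernel_polyE (Pk n).
have drb n := kernel_poly_darboux n Ptt Pk.
have rS n : c n.+2 = kappa - r n.+1 - lam n.+2 / r n.
  by rewrite /r (ratio_atS Ptt) //; ring.
have K0 : kernel_poly P kappa 0 = 1.
  apply: (mulfI XB0); rewrite step P1 P0 /ratio_at P1 P0 !hornerE divr1.
  by rewrite alg_polyC; ring.
split=> //.
- have <- : P 1%N + (lam 2 / r 0%N) *: 1 = kernel_poly P kappa 1.
    by rewrite drb K0 -/r subrK.
  have -> : P 1%N = 'X - kappa%:P + (r 0%N)%:P.
    by move: (step 0%N); rewrite K0 mulr1 P0 alg_polyC => ->; rewrite subrK.
  rewrite rS alg_polyC; ring.
- case=> // n _ /=.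
  have -> : lam n.+2 * (r n.+1 / r n) = r n.+1 * (lam n.+2 / r n) by ring.
  have -> : 'X * kernel_poly P kappa n.+1 =
      P n.+2 - r n.+1 *: P n.+1 + kappa *: kernel_poly P kappa n.+1.
    by rewrite -step -mul_polyC; ring.
  (* Only kernel polynomials remain; with the quotients kept opaque the claim is a polynomial
     identity. *)
  rewrite !drb rS -/r; set e1 := lam n.+3 / _; set e0 := lam n.+2 / _.
  rewrite -!mul_polyC; ring.
- case=> [|[|n]] // _ /=.
  by rewrite !mulf_neq0 ?invr_neq0 // lam0.
Qed.

(** For m <= n the new functional sends K_n K_m to L((P_{n+1} - r_n P_n) K_m). As K_m has degree m,
    this is 0 for m < n and -r_n L(P_n^2), which is nonzero, for m = n. *)
Lemma monic_OPS_kernel_poly (R : realType) (L : {scalar {poly R[i]}})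
    (P : nat -> {poly R[i]}) (c lam : nat -> R[i]) (kappa : R[i]) :
  monic_OPS L P ->
  three_term_recurrence P c lam -> (forall n, (P n).[kappa] != 0) ->
  monic_OPS (christoffel kappa L) (kernel_poly P kappa).
Proof.
move=> [Pmon Psz Porth Psq] Ptt Pk; set K := kernel_poly P kappa.
pose r := ratio_at P kappa.
have r0 n : r n != 0 by rewrite mulf_neq0 ?invr_neq0.
have step n : ('X - kappa%:P) * K n = P n.+1 - r n *: P n.
  exact: kernel_polyE.
have drb n := kernel_poly_darboux n Ptt Pk.
have lowdeg n : (size (r n *: P n) < size (P n.+1))%N.
  by rewrite Psz ltnS (leq_trans (size_scale_leq _ _)) // Psz.
have Ksz n : size (K n) = n.+1.
  have K0 : K n != 0.
    apply/eqP => K0; have /eqP := step n; rewrite K0 mulr0 eq_sym subr_eq0.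
    by move=> /eqP E; have := lowdeg n; rewrite E ltnn.
  apply: succn_inj; rewrite -(Psz n.+1).
  rewrite -(size_polyDl (p := P n.+1) (q := - (r n *: P n))).
    by rewrite -step mulrC size_Mmonic ?monicXsubC // size_XsubC addn2.
  by rewrite size_polyN.
have Kmon n : K n \is monic.
  rewrite -(monicMl _ (monicXsubC kappa)) step monicE.
  rewrite lead_coefDl ?size_polyN //.
  exact: Pmon.
have K0 : K 0%N = P 0%N.
  have [P0 _ _ _] := Ptt; rewrite P0; move: (Kmon 0%N) (Ksz 0%N).
  rewrite monicE lead_coefE => /eqP + Ks.
  by rewrite Ks [K 0%N]size1_polyC ?Ks // coefC /= => ->.
(* The Darboux relation expands K_m in P_0, ..., P_m, all orthogonal to P_n. *)
have LPK n m : (m < n)%N -> L (P n * K m) = 0.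
  elim: m => [|m IH] mn.
    by rewrite K0 Porth // gtn_eqF.
  have -> : K m.+1 = P m.+1 + (lam m.+2 / r m) *: K m by rewrite drb subrK.
  rewrite mulrDr -scalerAr linearD linearZ /= IH 1?ltnW // mulr0 addr0.
  by rewrite Porth // gtn_eqF.
have LPKn n : L (P n * K n) = L (P n ^+ 2).
  case: n => [|n]; first by rewrite K0.
  rewrite expr2 {3}[P n.+1]drb mulrBr -scalerAr linearB linearZ /=.
  by rewrite (LPK n.+1 n) // mulr0 subr0.
split=> //.
- move=> n m; wlog mn : n m / (m < n)%N => [wl nm|_].
    case: (ltngtP m n) => [mn|nm'|E]; first exact: wl.
      by rewrite mulrC; apply: wl => //; rewrite eq_sym.
    by rewrite E eqxx in nm.
  rewrite /= /christoffel mulrA step mulrBl -scalerAl linearB linearZ /=.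
  by rewrite !LPK ?mulr0 ?subrr // ltnW.
- move=> n; rewrite /= /christoffel expr2 mulrA step mulrBl -scalerAl linearB.
  by rewrite linearZ /= LPK // LPKn sub0r oppr_eq0 mulf_neq0.
Qed.

(** * Passage of the limits to the transformed coefficients *)

Theorem proposition3p3 (R : realType) (L : {scalar {poly R[i]}})
    (P : nat -> {poly R[i]}) (J : infinite_matrix R) (a c : R) (kappa : R[i]) :
  positive_definite L ->
  monic_OPS L P ->
  is_monic_jacobi_of P J ->
  0 <= a ->
  kappa \isn't Num.real ->
  nevai_class a c J ->
  exists Jstar : infinite_matrix R,
    [/\ monic_OPS (christoffel kappa L) (kernel_poly P kappa),
        is_monic_jacobi_of (kernel_poly P kappa) Jstar
      & nevai_class a c Jstar].
Proof.
move=> Lpos POPS [cc [lam [Ptt ->]]] _ kreal [Jc Ja].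
have y0 : complex.Im kappa != 0.
  by apply: contra kreal; case: kappa => x y /=; rewrite complex_real.
have [creal lam0] := monic_OPS_jacobi_real Lpos POPS Ptt.
have Pr n := relIm_ratio_at_ge1 n Ptt creal lam0 y0.
have Pk n := proj1 (Pr n); have v1 n := proj2 (Pr n).
pose r := ratio_at P kappa.
have := three_term_kernel_poly Ptt Pk; rewrite -/r /= => Ktt.
set cs := (fun n => cc n.+1 + _) in Ktt; set ls := (fun n => lam n * _) in Ktt.
exists (monic_jacobi_mx cs ls); split.
- exact: monic_OPS_kernel_poly POPS Ptt Pk.
- by exists cs, ls.
have jacd (u w : nat -> R[i]) n : monic_jacobi_mx u w n n = u n.+1.
  by rewrite /monic_jacobi_mx eqxx.
have jacs (u w : nat -> R[i]) n : monic_jacobi_mx u w n.+1 n = w n.+2.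
  by rewrite /monic_jacobi_mx eqxx !ltn_eqF.
(* The transformed diagonal involves the coefficients one index further. *)
have {}Jc : cc n.+2 @[n --> \oo] --> (c%:C : R[i]^o).
  rewrite (@cvg_shiftS R[i]^o (fun n => cc n.+1)).
  by move: Jc; under eq_fun do rewrite jacd.
have {}Ja : lam n.+2 @[n --> \oo] --> (a%:C : R[i]^o).
  by move: Ja; under eq_fun do rewrite jacs.
have rd : normc (r n.+1 - r n) @[n --> \oo] --> (0 : R).
  apply: (@ratio_diff_cvg0 _ kappa (fun n => complex.Re (cc n.+2))
    (fun n => complex.Re (lam n.+2)) r a c) => //.
  - by move=> n; rewrite -ltcR RRe_real ?gtr0_real.
  - by apply: cvg_Re_real Jc => n; exact: creal.
  - by apply: cvg_Re_real Ja => n; exact/gtr0_real.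
  - move=> n; rewrite /r (ratio_atS Ptt) //.
    by rewrite (RRe_real (creal _)) (RRe_real (gtr0_real (lam0 n))).
have r_ge n : `|complex.Im kappa| <= normc (r n) by exact: normc_ge_Im.
have y_gt0 : 0 < `|complex.Im kappa| by rewrite normr_gt0.
have {}rd : normc (r n.+1 - r n - 0) @[n --> \oo] --> (0 : R).
  by under eq_fun do rewrite subr0.
(* Since |r_n| is bounded below by |Im kappa|, vanishing differences force the quotients to tend to
   1. *)
have rq : normc (r n.+1 / r n - 1) @[n --> \oo] --> (0 : R).
  apply: (@squeeze_cvgr _ _ _ _ (fun=> 0)
    (fun n => normc (r n.+1 - r n - 0) / `|complex.Im kappa|)).
  - apply: nearW => n; rewrite normc_ge0 /= subr0.
    have rn0 : r n != 0 by rewrite mulf_neq0 ?invr_neq0.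
    have -> : r n.+1 / r n - 1 = (r n.+1 - r n) / r n by field.
    rewrite normcM normcV ler_wpM2l ?normc_ge0 // lef_pV2 ?posrE //.
    exact: lt_le_trans (r_ge n).
  - exact: cvg_cst.
  - rewrite -(mul0r `|complex.Im kappa|^-1).
    by apply: cvgM => //; exact: cvg_cst.
move: Jc Ja => /cvg_normcP Jc /cvg_normcP Ja; split; apply/cvg_normcP.
  under eq_fun do rewrite jacd /cs /= -[c%:C]addr0.
  exact: normc_cvgD.
under eq_fun do rewrite jacs /ls /= -[a%:C]mulr1.
exact: normc_cvgM.
Qed.
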